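(* Let $\alpha,\delta,\eta:[t_0,T]\to\mathbb{R}$ be differentiable functions, let $h:\mathbb{R}^n\to\mathbb{R}$ be twice differentiable and strongly convex, and let $f:\mathbb{R}^n\to\mathbb{R}$ be differentiable, convex and $\sigma$-uniformly convex with respect to $h$ for some $\sigma\ge 0$. Consider the Lagrangian $$\mathcal{L}(x,v,t)=e^{\delta(t)}\bigl(e^{\eta(t)}\mathcal{D}_h(x+e^{-\alpha(t)}v,\,x)-f(x)\bigr),$$ and for a curve $x(t)$ put $z(t)=x(t)+e^{-\alpha(t)}\dot x(t)$. Then the Euler--Lagrange equation associated with $\mathcal{L}$, $$\frac{d}{dt}\nabla_v\mathcal{L}(x(t),\dot x(t),t)-\nabla_x\mathcal{L}(x(t),\dot x(t),t)=0,$$ results in the following state equation for $(x(t),z(t))$: $$\begin{cases}\dot x(t)=e^{\alpha(t)}(z(t)-x(t)),\\ \nabla^2h(z(t))\,\dot z(t)=-\bigl(\dot\delta(t)+\dot\eta(t)-\dot\alpha(t)-e^{\alpha(t)}\bigr)\bigl[\nabla h(z(t))-\nabla h(x(t))\bigr]-e^{-\eta(t)+\alpha(t)}\nabla f(x(t)).\end{cases}$$ Moreover, this state equation is expressed by the ODE $$\ddot x(t)+(e^{\alpha(t)}-\dot\alpha(t))\dot x(t)+[\nabla^2h(z(t))]^{-1}\Bigl(e^{\alpha(t)}\bigl(\dot\delta(t)+\dot\eta(t)-\dot\alpha(t)-e^{\alpha(t)}\bigr)[\nabla h(z(t))-\nabla h(x(t))]+e^{-\eta(t)+2\alpha(t)}\nabla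 f(x(t))\Bigr)=0,$$ where $z(t)=x(t)+e^{-\alpha(t)}\dot x(t)$.
   Context: The Bregman divergence of a differentiable convex function $h$ is $\mathcal{D}_h(y,x)=h(y)-h(x)-\nabla h(x)^\top(y-x)$. A differentiable $f$ is $\sigma$-uniformly convex with respect to $h$ ($\sigma\ge0$) if $\mathcal{D}_f(y,x)\ge\sigma\mathcal{D}_h(y,x)$ for all $x,y$. $\nabla_x\mathcal{L}$ and $\nabla_v\mathcal{L}$ denote the partial gradients of $\mathcal{L}(x,v,t)$ in its first and second arguments, evaluated at the indicated point. A dot denotes $d/dt$. It is assumed that the ODE has a (twice differentiable) solution $x(t)$ on the considered time interval $[t_0,T]$. *)

(* Defs.v *)
From HB Require Import structures.
From mathcomp Require Import all_boot all_order all_algebra.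
From mathcomp Require Import all_classical all_reals all_analysis.

Set Implicit Arguments.
Unset Strict Implicit.
Unset Printing Implicit Defensive.
Import Order.TTheory GRing.Theory Num.Theory.
Import numFieldNormedType.Exports.

Local Open Scope classical_set_scope.
Local Open Scope ring_scope.

(* Derivative at [t] of a function regarded as defined on [A] only: for [A] a
   nondegenerate closed interval, this is the one-sided derivative at the
   endpoints and the usual derivative in the interior. As with ['D_v f], the
   value is meaningful only together with [derivable_within]. *)
Definition derivable_within (R : realType) (V : normedModType R)
    (A : set R) (g : R -> V) (t : R) : Prop :=
  cvg ((fun s : R => (s - t)^-1 *: (g s - g t)) @ within A t^').

Definition derive_within (R : realType) (V : normedModType R)
    (A : set R) (g : R -> V) (t : R) : V :=
  lim ((fun s : R => (s - t)^-1 *: (g s - g t)) @ within A t^').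

Definition derivable_on (R : realType) (V : normedModType R)
    (A : set R) (g : R -> V) : Prop :=
  forall t, A t -> derivable_within A g t.

Definition dot (R : realType) (n : nat) (u v : 'cV[R]_n) : R :=
  \sum_(i < n) u i 0 * v i 0.

Definition grad (R : realType) (n : nat) (h : 'cV[R]_n -> R) (x : 'cV[R]_n)
    : 'cV[R]_n :=
  \col_i 'D_(delta_mx i 0) h x.

Definition hess (R : realType) (n : nat) (h : 'cV[R]_n -> R) (x : 'cV[R]_n)
    : 'M[R]_n :=
  \matrix_(i, j) 'D_(delta_mx j 0) (fun y => grad h y i 0) x.

(* Frechet sense; no continuity of the Hessian is required. *)
Definition twice_differentiable (R : realType) (n : nat) (h : 'cV[R]_n -> R)
    : Prop :=
  (forall x, differentiable h x) /\ (forall x, differentiable (grad h) x).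

(* The Euclidean norm is used: the library's norm on ['cV[R]_n] is the sup
   norm. *)
Definition strongly_convex (R : realType) (n : nat) (h : 'cV[R]_n -> R)
    : Prop :=
  exists2 mu : R, 0 < mu &
    forall (x y : 'cV[R]_n) (l : R), 0 <= l <= 1 ->
      h (l *: x + (1 - l) *: y) <=
        l * h x + (1 - l) * h y - mu / 2 * l * (1 - l) * dot (x - y) (x - y).

Definition bregman (R : realType) (n : nat) (h : 'cV[R]_n -> R)
    (y x : 'cV[R]_n) : R :=
  h y - h x - dot (grad h x) (y - x).

Definition uniformly_convex_wrt (R : realType) (n : nat) (sigma : R)
    (h f : 'cV[R]_n -> R) : Prop :=
  forall x y : 'cV[R]_n, sigma * bregman h y x <= bregman f y x.

Definition lagrangian (R : realType) (n : nat) (alpha delta eta : R -> R)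
    (h f : 'cV[R]_n -> R) (x v : 'cV[R]_n) (t : R) : R :=
  expR (delta t) *
    (expR (eta t) * bregman h (x + expR (- alpha t) *: v) x - f x).

(* Besides the equation itself, solving it means that the derivatives occurring
   in it exist. *)
Definition euler_lagrange (R : realType) (n : nat) (A : set R)
    (L : 'cV[R]_n -> 'cV[R]_n -> R -> R) (x : R -> 'cV[R]_n) : Prop :=
  let dx := derive_within A x in
  let grad_x t := grad (fun u => L u (dx t) t) (x t) in
  let grad_v t := grad (fun v => L (x t) v t) (dx t) in
  forall t, A t ->
    [/\ differentiable (fun u => L u (dx t) t) (x t),
        differentiable (fun v => L (x t) v t) (dx t),
        derivable_within A grad_v t &
        derive_within A grad_v t - grad_x t = 0].

Definition zcurve (R : realType) (n : nat) (A : set R) (alpha : R -> R)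
    (x : R -> 'cV[R]_n) (t : R) : 'cV[R]_n :=
  x t + expR (- alpha t) *: derive_within A x t.

Definition state_equation (R : realType) (n : nat) (A : set R)
    (alpha delta eta : R -> R) (h f : 'cV[R]_n -> R)
    (x z : R -> 'cV[R]_n) : Prop :=
  let d := derive_within A in
  forall t, A t ->
    [/\ derivable_within A x t, derivable_within A z t,
        derive_within A x t = expR (alpha t) *: (z t - x t) &
        hess h (z t) *m derive_within A z t =
          - (d delta t + d eta t - d alpha t - expR (alpha t))
              *: (grad h (z t) - grad h (x t))
          - expR (- eta t + alpha t) *: grad f (x t)].

(* Invertibility of the Hessian is part of the meaning of the equation: [invmx]
   returns its argument on singular matrices. *)
Definition second_order_ode (R : realType) (n : nat) (A : set R)
    (alpha delta eta : R -> R) (h f : 'cV[R]_n -> R)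
    (x : R -> 'cV[R]_n) : Prop :=
  let d := derive_within A in
  let dx := derive_within A x in
  let z := zcurve A alpha x in
  forall t, A t ->
    [/\ derivable_within A x t, derivable_within A dx t,
        hess h (z t) \in unitmx &
        derive_within A dx t + (expR (alpha t) - d alpha t) *: dx t
        + invmx (hess h (z t)) *m
            ((expR (alpha t) * (d delta t + d eta t - d alpha t - expR (alpha t)))
                *: (grad h (z t) - grad h (x t))
             + expR (- eta t + 2 * alpha t) *: grad f (x t)) = 0].

(* Main.v *)
(* Writing z = x + e^(-alpha) v, the gradients of the Lagrangian are
     grad_v L = e^(delta + eta - alpha) (grad h (z) - grad h (x)),
     grad_x L = e^delta (e^eta (grad h (z) - grad h (x)
                  - e^(-alpha) hess h (x)^T v) - grad f (x)).
   Differentiating grad_v L along the curve produces -hess h (x) x', which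
   cancels against the term hess h (x)^T x' of grad_x L because the Hessian is
   symmetric; what is left is e^(delta + eta - alpha) times the residual of the
   state equation. Symmetry only assumes that h is twice Frechet
   differentiable, so it is obtained from the mean value theorem applied to
   second differences. Strong convexity makes grad h strongly monotone, hence
   the Hessian positive definite and invertible, and x'' is e^alpha z' up to
   first-order terms, which gives the second-order ODE. *)
Require Import Defs.
From HB Require Import structures.
From mathcomp Require Import all_boot all_order all_algebra.
From mathcomp Require Import all_classical all_reals all_analysis.
From mathcomp Require Import ring lra.

Set Implicit Arguments.
Unset Strict Implicit.
Unset Printing Implicit Defensive.
Import Order.TTheory GRing.Theory Num.Theory.
Import numFieldNormedType.Exports.

Local Open Scope classical_set_scope.
Local Open Scope ring_scope.

(** * First-order expansions and symmetry of second directional derivatives *)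

Section differential.
Context {R : realType} {V : normedModType R}.

Lemma near_diff_le (W : normedModType R) (F : V -> W) (x : V) (e : R) :
  differentiable F x -> 0 < e ->
  \forall k \near 0, `|F (k + x) - F x - 'd F x k| <= e * `|k|.
Proof.
move=> /diff_locallyP[_ /eqaddoP dF] e0.
by apply: filterS (dF _ e0) => k /=; rewrite opprD addrA.
Qed.

Lemma near_diff_line_le (W : normedModType R) (F : V -> W) (x v : V) (e : R) :
  differentiable F x -> 0 < e ->
  \forall s \near 0^'+, `|F (s *: v + x) - F x - s *: 'd F x v| <= e * s.
Proof.
(* Adding 1 keeps the divisor positive when [v] is zero. *)
move=> dF e0; have v0 : 0 < `|v| + 1 by rewrite ltr_wpDl.
have /nbhs_ballP[d /= d0 dP] := near_diff_le dF (divr_gt0 e0 v0).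
near=> s.
have s0 : 0 < s by [].
have sd : s * (`|v| + 1) < d.
  by rewrite -ltr_pdivlMr //; near: s; apply: nbhs_right_lt; rewrite divr_gt0.
have sv : `|s *: v| <= s * (`|v| + 1).
  by rewrite normrZ gtr0_norm // ler_pM2l // lerDl.
have := dP (s *: v); rewrite -ball_normE /= sub0r normrN => /(_ (le_lt_trans sv sd)).
rewrite [in X in _ - _ - X]linearZ => /le_trans; apply.
apply: le_trans (ler_wpM2l _ sv) _; first by rewrite divr_ge0 // ltW.
by rewrite mulrCA divfK ?gt_eqF // mulrC.
Unshelve. all: by end_near. Qed.

(** After regrouping, the difference quotient at [r] is the one that defines the directional
    derivative of [F] at [r *: u + c]. *)
Lemma is_derive_line (W : normedModType R) (F : V -> W) (u c : V) (r : R) :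
  differentiable F (r *: u + c) ->
  is_derive r 1 (fun s => F (s *: u + c)) ('D_u F (r *: u + c)).
Proof.
move=> dF; have E : (fun k : R =>
    k^-1 *: (F ((k *: (1 : R^o) + r) *: u + c) - F (r *: u + c)))
  = (fun k => k^-1 *: (F (k *: u + (r *: u + c)) - F (r *: u + c))).
  by apply/funext => k; rewrite [_%:A]mulr1 scalerDl addrA.
have := @diff_derivable _ _ _ F (r *: u + c) u dF.
rewrite /derivable -E => dd; split; first exact: dd.
by rewrite /derive -E.
Qed.

(** The second difference is an increment of [psi], the difference of [h] along two parallel lines
    of direction [u]. The mean value theorem turns it into [s] times a difference of two values of
    ['D_u h], and both are expanded at the single point [x], so no continuity of second derivatives
    enters. *)
Lemma near_second_difference (h : V -> R) (x u v : V) (e : R) :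
  (forall y, differentiable h y) -> differentiable ('D_u h) x -> 0 < e ->
  \forall s \near 0^'+,
    `|h (s *: u + (s *: v + x)) - h (s *: u + x) - h (s *: v + x) + h x
      - s ^+ 2 * 'D_v ('D_u h) x| <= e * s ^+ 2.
Proof.
move=> dh dG e0; set M := `|u| + `|v| + 1.
have M0 : 0 < M by rewrite ltr_wpDl // addr_ge0.
(* The displacements [r *: u + s *: v] and [r *: u] have norm at most [s * M], so this tolerance
   makes the two expansion errors sum to at most [e * s]. *)
have /nbhs_ballP[d /= d0 dP] := near_diff_le dG 
  (divr_gt0 e0 (mulr_gt0 (ltr0Sn R 1) M0) : 0 < e / (2%:R * M)).
near=> s.
have s0 : 0 < s by [].
have sd : s * M < d.
  by rewrite -ltr_pdivlMr //; near: s; apply: nbhs_right_lt; rewrite divr_gt0.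
pose psi (r : R) := h (r *: u + (s *: v + x)) - h (r *: u + x).
pose dpsi (r : R) : R := 'D_u h (r *: u + (s *: v + x)) - 'D_u h (r *: u + x).
have psiD (r : R) : is_derive r 1 psi (dpsi r).
  by apply: is_deriveB; apply: is_derive_line.
have psiC : {within `[0, s], continuous psi}.
  apply: derivable_within_continuous => r _; exact: ex_derive.
have [r rs] := MVT s0 (fun r _ => psiD r) psiC.
rewrite subr0 /psi !scale0r !add0r => E.
have -> : h (s *: u + (s *: v + x)) - h (s *: u + x) - h (s *: v + x) + h x =
   h (s *: u + (s *: v + x)) - h (s *: u + x) - (h (s *: v + x) - h x) by ring.
rewrite E /dpsi (deriveE _ dG).
move: rs; rewrite in_itv /= => /andP[r0 rs].
have nru : `|r *: u| <= s * `|u| by rewrite normrZ gtr0_norm // ler_wpM2r // ltW.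
have nw : `|r *: u + s *: v| <= s * (`|u| + `|v|).
  rewrite (le_trans (ler_normD _ _)) // mulrDr lerD //.
  by rewrite normrZ gtr0_norm.
have b1 : `|r *: u| <= s * M.
  by rewrite (le_trans nru) // ler_wpM2l ?(ltW s0) // /M -addrA lerDl addr_ge0.
have b2 : `|r *: u + s *: v| <= s * M.
  by rewrite (le_trans nw) // ler_wpM2l ?(ltW s0) // /M lerDl.
have := dP (r *: u); have := dP (r *: u + s *: v).
rewrite -!ball_normE /ball_/= !sub0r !normrN -[_ *: _ + _ + x]addrA.
move=> /(_ (le_lt_trans b2 sd)) P2 /(_ (le_lt_trans b1 sd)) P1.
have dE : 'd ('D_u h) x (r *: u + s *: v) =
    'd ('D_u h) x (r *: u) + s * 'd ('D_u h) x v by rewrite linearD [in X in _ + X]linearZ.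
rewrite dE in P2.
set A := 'D_u h (_ + (_ + _)) in P2 *; set B := 'D_u h (_ + _) in P1 *.
set C := 'D_u h x in P1 P2; set D := 'd ('D_u h) x (r *: u) in P1 P2.
set Ev := 'd ('D_u h) x v in P2 *.
(* The unknown mean value point [r] drops out: its contribution [D] is common to both expansions. *)
have -> : (A - B) * s - s ^+ 2 * Ev = s * ((A - C - (D + s * Ev)) - (B - C - D)) by ring.
rewrite normrM gtr0_norm // expr2 mulrCA ler_pM2l //.
rewrite (le_trans (ler_normB _ _)) // (le_trans (lerD P2 P1)) // -mulrDr.
have := lerD b2 b1 => b3.
rewrite (le_trans (ler_wpM2l _ b3)) ?divr_ge0 ?(ltW e0) ?mulr_ge0 ?(ltW M0) //.
by rewrite le_eqVlt; apply/orP; left; apply/eqP; field; rewrite gt_eqF.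
Unshelve. all: by end_near. Qed.

(** The second difference is symmetric in [u] and [v], so after division by [s ^+ 2] it approximates
    both iterated derivatives. *)
Lemma derive_comm (h : V -> R) (x u v : V) :
  (forall y, differentiable h y) ->
  differentiable ('D_u h) x -> differentiable ('D_v h) x ->
  'D_v ('D_u h) x = 'D_u ('D_v h) x.
Proof.
move=> dh du dv; apply/eqP; rewrite -subr_eq0 -normr_le0.
apply/ler_addgt0Pl => e e0; rewrite addr0.
have e20 : 0 < e / 2 by rewrite divr_gt0.
(* One common [s] at which both estimates hold, each with half of the error. *)
have [s [[P1 P2] s0]] := filter_ex (filterI (filterI
  (near_second_difference v dh du e20) (near_second_difference u dh dv e20))
  (nbhs_right_gt (0 : R))).
rewrite [s *: v + (_ + _)]addrCA in P2.
have s20 : 0 < s ^+ 2 by rewrite exprn_gt0.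
rewrite -(ler_pM2r s20) -[X in _ * X <= _](gtr0_norm s20) -normrM.
rewrite [e in leRHS]splitr [leRHS]mulrDl (le_trans _ (lerD P2 P1)) //.
rewrite (le_trans _ (ler_normB _ _)) // le_eqVlt; apply/orP; left; apply/eqP.
by congr (`| _ |); move: ('D_v _ _) ('D_u _ _) (h _) (h _) (h _) (h _) => *; ring.
Qed.
End differential.

(** * Calculus of derivatives relative to a set *)

Section derive_within.
Context {R : realType} (A : set R).
Implicit Types (V W : normedModType R) (t : R).

(** Existence and value in one relation, so that the rules compose; only reading the value off as a
    [lim] calls for a proper filter. Taking [l] to be [derive_within A g t] gives back
    [derivable_within] by conversion. *)
Definition is_derive_within V (g : R -> V) t (l : V) : Prop :=
  (fun s : R => (s - t)^-1 *: (g s - g t)) @ within A t^' --> l.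

Lemma is_derive_within_derivable V (g : R -> V) t l :
  is_derive_within g t l -> derivable_within A g t.
Proof. by move=> gl; apply/cvg_ex; exists l. Qed.

Lemma derive_withinE V (g : R -> V) t l : ProperFilter (within A t^') ->
  is_derive_within g t l -> derive_within A g t = l.
Proof. by move=> PF; apply: cvg_lim. Qed.

Lemma near_within_dnbhs t : \forall s \near within A t^', A s /\ s != t.
Proof.
rewrite near_withinE; near=> s => As; split=> //.
by near: s; exact: nbhs_dnbhs_neq.
Unshelve. all: by end_near. Qed.

Lemma eq_is_derive_within V (f g : R -> V) t l :
  {in A, f =1 g} -> A t -> is_derive_within f t l -> is_derive_within g t l.
Proof.
move=> fg At; apply: cvg_trans; apply: near_eq_cvg.
near=> s; have [As _] : A s /\ s != t by near: s; exact: near_within_dnbhs.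
by rewrite !fg // inE.
Unshelve. all: by end_near. Qed.

Lemma is_derive_within_cvg V (g : R -> V) t l :
  is_derive_within g t l -> g s @[s --> within A t^'] --> g t.
Proof.
move=> gl; apply/subr_cvg0.
have st : s @[s --> within A t^'] --> t.
  exact: cvg_trans (@cvg_within _ t^' _ A) (@nbhs_dnbhs _ t).
have : (s - t) *: ((s - t)^-1 *: (g s - g t)) @[s --> within A t^'] --> (0 : V).
  by rewrite -(scale0r l) -(subrr t); apply: cvgZ gl; exact: cvgB st (cvg_cst t).
apply: cvg_trans; apply: near_eq_cvg.
near=> s; have [_ st0] : A s /\ s != t by near: s; exact: near_within_dnbhs.
by rewrite /= scalerA divff ?scale1r // subr_eq0.
Unshelve. all: by end_near. Qed.

Lemma is_derive_withinD V (f g : R -> V) t k l :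
  is_derive_within f t k -> is_derive_within g t l ->
  is_derive_within (fun s => f s + g s) t (k + l).
Proof.
move=> fk gl; apply: cvg_trans (cvgD fk gl); apply: near_eq_cvg.
by apply: nearW => s /=; rewrite opprD addrACA scalerDr.
Qed.

Lemma is_derive_withinN V (f : R -> V) t k :
  is_derive_within f t k -> is_derive_within (fun s => - f s) t (- k).
Proof.
move=> fk; apply: cvg_trans (cvgN fk); apply: near_eq_cvg.
by apply: nearW => s /=; rewrite -opprD scalerN.
Qed.

Lemma is_derive_withinZ V (a : R -> R) (g : R -> V) t (k : R) l :
  is_derive_within a t k -> is_derive_within g t l ->
  is_derive_within (fun s => a s *: g s) t (k *: g t + a t *: l).
Proof.
move=> ak gl; apply: cvg_trans (cvgD
  (cvgZ ak (is_derive_within_cvg gl)) (cvgZ (cvg_cst (a t)) gl)); apply: near_eq_cvg.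
apply: nearW => s; transitivity
  (((s - t)^-1 *: (a s - a t)) *: g s + a t *: ((s - t)^-1 *: (g s - g t))) => //=.
rewrite !scalerA [a t * _]mulrC -!scalerA -scalerDr scalerBl scalerBr.
by rewrite addrA subrK.
Qed.

(** The quotient of [F \o g] is ['d F] applied to the quotient of [g], which converges by continuity
    of the differential, plus a remainder [rem] that tends to 0. *)
Lemma is_derive_within_comp V W (F : V -> W) (g : R -> V) t l :
  differentiable F (g t) -> is_derive_within g t l ->
  is_derive_within (F \o g) t ('d F (g t) l).
Proof.
move=> dF gl; have dFl : 'd F (g t) ((s - t)^-1 *: (g s - g t)) @[s --> within A t^']
    --> 'd F (g t) l.
  have dc : continuous ('d F (g t)) by exact: diff_continuous.
  apply: (cvg_comp _ _ gl (dc l)).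
pose rem s := (s - t)^-1 *: (F (g s) - F (g t) - 'd F (g t) (g s - g t)).
suff rem0 : rem s @[s --> within A t^'] --> (0 : W).
  rewrite /is_derive_within -['d F (g t) l]add0r.
  apply: cvg_trans (cvgD rem0 dFl); apply: near_eq_cvg.
  apply: nearW => s.
  transitivity (rem s + 'd F (g t) ((s - t)^-1 *: (g s - g t))) => //.
  by rewrite /rem linearZ -scalerDr subrK.
apply/cvgr0Pnorm_le => e e0.
(* The quotient of [g] is eventually bounded by this constant, since its limit has norm strictly
   below it. *)
have l0 : 0 < `|l| + 1 by rewrite ltr_wpDl.
have gt0 : g s - g t @[s --> within A t^'] --> (0 : V).
  by apply/subr_cvg0; exact: is_derive_within_cvg gl.
have Fg := gt0 _ (near_diff_le dF (divr_gt0 e0 l0)).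
near=> s.
have : `|F (g s - g t + g t) - F (g t) - 'd F (g t) (g s - g t)|
    <= e / (`|l| + 1) * `|g s - g t| by near: s.
rewrite subrK => Fs; rewrite normrZ.
have ql : `|(s - t)^-1 *: (g s - g t)| <= `|l| + 1.
  near: s; move/cvgr_norm_le: gl; apply; by rewrite ltrDl.
rewrite (le_trans (ler_wpM2l (normr_ge0 _) Fs)) // mulrCA -normrZ.
by rewrite -ler_pdivlMl ?divr_gt0 // invf_div divfK // gt_eqF.
Unshelve. all: by end_near. Qed.
End derive_within.

(** A nondegenerate interval has no isolated point; this is what makes derivatives relative to it
    unique, endpoints included. *)
Lemma within_itv_dnbhs_proper {R : realType} (a b t : R) : a < b ->
  `[a, b]%classic t -> ProperFilter (within `[a, b]%classic t^').
Proof.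
move=> ab; rewrite /= in_itv /= => /andP[at_ tb].
apply: Build_ProperFilter_ex => P.
rewrite /within /= => /nbhs_ballP[e /= e0 eP].
(* Step to the right of [t] if there is room, otherwise [t = b] and step to the left; the minimum
   keeps the point in both the ball and the interval. *)
have [tb'|] := ltP t b.
  exists (t + Num.min (e / 2) (b - t)); have m0 : 0 < Num.min (e / 2) (b - t).
    by rewrite lt_min divr_gt0 // subr_gt0.
  have me : Num.min (e / 2) (b - t) < e.
    by rewrite gt_min ltr_pdivrMr // mulr_natr mulr2n ltrDl e0.
  have mb : Num.min (e / 2) (b - t) <= b - t by rewrite ge_min lexx orbT.
  apply: eP => /=.
  - by rewrite -ball_normE /= opprD addNKr normrN gtr0_norm.
  - by rewrite -subr_eq0 addrC addKr gt_eqF.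
  - by rewrite in_itv /=; apply/andP; split; lra.
move=> bt; have tE : t = b by apply/eqP; rewrite eq_le tb.
have m0 : 0 < Num.min (e / 2) (b - a) by rewrite lt_min divr_gt0 // subr_gt0.
have me : Num.min (e / 2) (b - a) < e.
  by rewrite gt_min ltr_pdivrMr // mulr_natr mulr2n ltrDl e0.
have mb : Num.min (e / 2) (b - a) <= b - a by rewrite ge_min lexx orbT.
exists (b - Num.min (e / 2) (b - a)); apply: eP => /=.
- by rewrite -ball_normE /= tE opprB addrC subrK gtr0_norm.
- by rewrite tE lt_eqF // ltrBlDr ltrDl.
- by rewrite in_itv /=; apply/andP; split; lra.
Qed.

(** * Gradients, Hessians and the consequences of strong convexity *)

Section gradient.
Context {R : realType} {n : nat}.
Implicit Types (h : 'cV[R]_n -> R) (x y u v w : 'cV[R]_n).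

Lemma dotC u v : dot u v = dot v u.
Proof. by apply: eq_bigr => i _; rewrite mulrC. Qed.

Lemma dotDr u v w : dot u (v + w) = dot u v + dot u w.
Proof. by rewrite -big_split; apply: eq_bigr => i _; rewrite mxE mulrDr. Qed.

Lemma dotZr (a : R) u v : dot u (a *: v) = a * dot u v.
Proof. by rewrite mulr_sumr; apply: eq_bigr => i _; rewrite mxE mulrCA. Qed.

Lemma dotNr u v : dot u (- v) = - dot u v.
Proof. by rewrite -scaleN1r dotZr mulN1r. Qed.

Lemma dotDl u v w : dot (u + v) w = dot u w + dot v w.
Proof. by rewrite dotC dotDr !(dotC w). Qed.

Lemma dotZl (a : R) u v : dot (a *: u) v = a * dot u v.
Proof. by rewrite dotC dotZr dotC. Qed.

Lemma dotNl u v : dot (- u) v = - dot u v.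
Proof. by rewrite dotC dotNr dotC. Qed.

Lemma dot_mull (A : 'M[R]_n) u v : dot (A *m u) v = dot u (A^T *m v).
Proof.
have dotE p q : dot p q = (p^T *m q) 0 0.
  by rewrite mxE; apply: eq_bigr => i _; rewrite mxE.
by rewrite !dotE trmx_mul mulmxA.
Qed.

Lemma dot_delta u i : dot u (delta_mx i 0) = u i 0.
Proof.
rewrite /dot (bigD1 i) //= mxE !eqxx mulr1 big1 ?addr0 // => j ji.
by rewrite mxE (negPf ji) mulr0.
Qed.

Lemma dot_eq0 u : dot u u <= 0 -> u = 0.
Proof.
move=> uu; have sq i : 0 <= u i 0 * u i 0 by rewrite -expr2 sqr_ge0.
have /eqP : dot u u = 0 by apply/eqP; rewrite eq_le uu sumr_ge0.
rewrite psumr_eq0 // => /allP u0; apply/matrixP => i j; rewrite ord1 mxE.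
have := u0 i; rewrite mem_index_enum => /(_ isT) /implyP/(_ isT).
by rewrite mulf_eq0 orbb => /eqP.
Qed.

(** A continuous linear map is its own differential; continuity comes from writing it as a finite
    combination of coordinates. *)
Lemma is_diff_dot w x : is_diff x (dot w) (dot w).
Proof.
have dotl : linear (dot w) by move=> a u v; rewrite dotDr dotZr.
pose dl : {linear 'cV[R]_n -> R} := HB.pack (dot w) (GRing.isLinear.Build _ _ _ _ _ dotl).
have cd : continuous dl.
  move=> y; apply: differentiable_continuous.
  have -> : dl = \sum_(i < n) (w i 0 *: (fun u : 'cV[R]_n => u i 0 : R)) :> (_ -> R).
    by apply/funext => u; rewrite fct_sumE.
  by apply: differentiable_sum => i; apply: differentiableZ; exact: differentiable_coord.
by apply: DiffDef; [exact: (linear_differentiable (f := dl))|rewrite (diff_lin (f := dl))].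
Qed.

Lemma diff_gradE h x v : differentiable h x -> 'd h x v = dot (grad h x) v.
Proof.
move=> dh; rewrite {1}(matrix_sum_delta v) linear_sum; apply: eq_bigr => i _.
by rewrite big_ord1 linearZ /= -deriveE // mxE mulrC.
Qed.

(** Reads a gradient off a differential computed by the calculus rules. *)
Lemma grad_unique h x (g : 'cV[R]_n) (dh : 'cV[R]_n -> R) : is_diff x h dh ->
  (forall v, dh v = dot g v) -> grad h x = g.
Proof.
move=> hx dhE; apply/matrixP => i j; rewrite ord1 mxE deriveE; last exact: ex_diff.
by rewrite diff_val dhE dot_delta.
Qed.

Lemma grad_diff_hess h x v : differentiable (grad h) x ->
  'd (grad h) x v = hess h x *m v.
Proof.
move=> dg; rewrite {1}(matrix_sum_delta v) linear_sum.
apply/matrixP => i j; rewrite ord1 summxE mxE; apply: eq_bigr => k _.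
rewrite big_ord1 linearZ mxE mulrC; congr (_ * _).
rewrite -deriveE // derive_mx; last exact: diff_derivable.
by rewrite !mxE.
Qed.

(** The partial derivatives of [h] are coordinates of [grad h], hence differentiable, and
    [derive_comm] applies to each pair of basis vectors. *)
Lemma hess_sym h x : twice_differentiable h -> (hess h x)^T = hess h x.
Proof.
move=> [dh dg].
have gE i : (fun y => grad h y i 0) = 'D_(delta_mx i 0) h.
  by apply/funext => y; rewrite mxE.
have dgi i : differentiable ('D_(delta_mx i 0) h) x.
  rewrite -gE; pose p (N : 'cV[R]_n) : R := N i 0.
  by apply: (@differentiable_comp _ _ _ _ (grad h) p); [|exact: differentiable_coord].
by apply/matrixP => i j; rewrite !mxE !gE derive_comm.
Qed.

(** Use the convexity inequality at [s *: v + x], subtract [h x], divide by [s] and let [s] tend to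
    0. The limit is replaced by one [s] small enough for a given [e]. *)
Lemma strongly_convex_grad h (mu : R) x y :
  (forall x y (l : R), 0 <= l <= 1 ->
      h (l *: x + (1 - l) *: y) <=
        l * h x + (1 - l) * h y - mu / 2 * l * (1 - l) * dot (x - y) (x - y)) ->
  differentiable h x ->
  dot (grad h x) (y - x) <= h y - h x - mu / 2 * dot (y - x) (y - x).
Proof.
move=> hc dh; set v := y - x; rewrite -diff_gradE //.
apply/ler_addgt0Pl => e e0.
have e20 : 0 < e / 2 by rewrite divr_gt0.
(* Half of [e] pays for the differential, the other half for the leftover [s * (mu / 2) * dot v v],
   which [s <= e / 2 / M] controls. *)
pose M := `|mu / 2 * dot v v| + 1; have M0 : 0 < M by rewrite ltr_wpDl.
have [s [[[hs s0] s1] sM]] := filter_ex (filterI (filterI (filterI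
  (near_diff_line_le v dh e20) (nbhs_right_gt (0 : R)))
  (nbhs_right_le ltr01)) (nbhs_right_le (divr_gt0 e20 M0))).
have := hc y x s; rewrite (ltW s0) s1 => /(_ isT).
have -> : s *: y + (1 - s) *: x = s *: v + x.
  by rewrite /v scalerBl scale1r scalerBr addrA addrAC.
move: hs; rewrite -/v ler_norml => /andP[hs _] cs.
have {sM} : s * M <= e / 2 by rewrite -ler_pdivlMr.
have : mu / 2 * dot v v <= M by rewrite /M (le_trans (ler_norm _)) // lerDl.
rewrite -(ler_pM2l s0) => sD sM.
have sDe := ler_wpM2l (ltW s0) (le_trans sD sM).
rewrite -(ler_pM2l s0).
have scaleE : s *: 'd h x v = s * 'd h x v by [].
rewrite scaleE in hs; clear -hs cs sDe.
move: (h _) (h x) (h y) (dot v v) ('d h x v) hs cs sDe => p q r D d' hs cs sDe.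
lra.
Qed.

(** Adding the first-order inequalities at [x] and at [s *: v + x] gives strong monotonicity of
    [grad h] along [v]; differentiating [dot v (grad h _)] in direction [v] yields the bound. *)
Lemma strongly_convex_hess h (mu : R) x v :
  (forall x y (l : R), 0 <= l <= 1 ->
      h (l *: x + (1 - l) *: y) <=
        l * h x + (1 - l) * h y - mu / 2 * l * (1 - l) * dot (x - y) (x - y)) ->
  twice_differentiable h ->
  mu * dot v v <= dot (hess h x *m v) v.
Proof.
move=> hc [dh dg]; pose F := dot v \o grad h.
have dd := is_diff_dot v (grad h x).
have dF : differentiable F x.
  by apply: differentiable_comp.
have dFv : 'd F x v = dot (hess h x *m v) v.
  by rewrite diff_comp //= diff_val grad_diff_hess // dotC.
rewrite -dFv; apply/ler_addgt0Pl => e e0.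
have [s [hs s0]] := filter_ex (filterI (near_diff_line_le v dF e0) (nbhs_right_gt (0 : R))).
have h1 := strongly_convex_grad (s *: v + x) hc (dh x).
have h2 := strongly_convex_grad x hc (dh (s *: v + x)).
rewrite addrK dotZr dotZr dotZl in h1.
rewrite opprD addrCA subrr addr0 !dotNr dotNl !dotZr dotZl in h2.
have scaleE : s *: 'd F x v = s * 'd F x v by [].
move: hs; rewrite scaleE /F /= !(dotC v) ler_norml => /andP[_ hs].
(* The monotonicity inequality is of second order in [s], hence the two factors. *)
rewrite -(ler_pM2l s0) -(ler_pM2l s0) -/F.
have := ler_wpM2l (ltW s0) hs; rewrite -/F.
clear -h1 h2; move: (h _) (h x) (dot v v) (dot _ v) (dot (grad h x) v) ('d F x v) h1 h2
  => p q D a b c h1 h2 hs.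
lra.
Qed.


(** A row vector in the kernel is, by symmetry, a column vector killed by the Hessian; positive
    definiteness forces it to be 0. *)
Lemma hess_unit h x : twice_differentiable h -> strongly_convex h ->
  hess h x \in unitmx.
Proof.
move=> h2 [mu mu0 hc].
rewrite -row_free_unit -kermx_eq0; apply/rowV0P => w /sub_kermxP wH.
have Hw : hess h x *m w^T = 0 by rewrite -(hess_sym x h2) -trmx_mul wH trmx0.
apply: trmx_inj; rewrite trmx0; apply: dot_eq0.
have := strongly_convex_hess x w^T hc h2.
by rewrite Hw dotC -(scale0r 0) dotZr mul0r pmulr_rle0.
Qed.
End gradient.

Lemma is_derive_within_expR {R : realType} (A : set R) (a : R -> R) (t k : R) :
  is_derive_within A a t k ->
  is_derive_within A (fun s => expR (a s)) t (k * expR (a t)).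
Proof.
move=> ak; have de : differentiable (@expR R) (a t).
  by apply/derivable1_diffP; exact: derivable_expR.
have := is_derive_within_comp de ak.
suff -> : 'd (@expR R) (a t) k = k * expR (a t) by [].
by rewrite diff1E // derive1E (@derive_val _ _ _ _ _ _ _ (is_derive_expR _)).
Qed.

(** * Partial gradients of the Lagrangian *)

Section lagrangian_gradients.
Context {R : realType} {n : nat} (h f : 'cV[R]_n -> R).
Hypotheses (h2 : twice_differentiable h) (df : forall x, differentiable f x).

Let is_diff_h x : is_diff x h ('d h x).
Proof. by apply: DiffDef => //; exact: h2.1. Qed.

Let is_diff_grad x : is_diff x (grad h) ('d (grad h) x).
Proof. by apply: DiffDef => //; exact: h2.2. Qed.

Lemma is_diff_bregman_fst (x v : 'cV[R]_n) (c : R) :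
  is_diff v (fun v => bregman h (x + c *: v) x)
    (dot (c *: (grad h (x + c *: v) - grad h x))).
Proof.
have -> : (fun v => bregman h (x + c *: v) x) =
    (h \o (cst x + c \*: id)) - cst (h x) - (c *: dot (grad h x)).
  by apply/funext => w; rewrite /bregman [x + _ - x]addrC addKr dotZr.
have dz := is_diffD (is_diff_cst x v) (is_diffZ c (is_diff_id v)).
have dhz := is_diff_comp dz (is_diff_h _).
apply: (is_diff_eq (is_diffB (is_diffB dhz (is_diff_cst (h x) v))
  (is_diffZ c (is_diff_dot (grad h x) v)))).
apply/funext => w; transitivity ('d h (x + c *: v) (0 + c *: w) - 0 - c * dot (grad h x) w) => //.
have -> : 'd h (x + c *: v) (0 + c *: w) = c * dot (grad h (x + c *: v)) w.
  by rewrite add0r -dotZr; apply: diff_gradE; exact: h2.1.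
rewrite subr0 dotZl -mulrBr.
by rewrite dotDl dotNl.
Qed.

(** Both arguments move while their difference [p] stays fixed, so the Hessian comes only from
    differentiating [dot p (grad h u)]; its symmetry lets it act on [p]. *)
Lemma is_diff_bregman_shift (u p : 'cV[R]_n) :
  is_diff u (fun u => bregman h (u + p) u)
    (dot (grad h (u + p) - grad h u - hess h u *m p)).
Proof.
have -> : (fun u => bregman h (u + p) u) =
    (h \o (id + cst p)) - h - (dot p \o grad h).
  by apply/funext => w; rewrite /bregman [w + _ - w]addrC addKr dotC.
have dz := is_diffD (is_diff_id u) (is_diff_cst p u).
have dhz := is_diff_comp dz (is_diff_h _).
apply: (is_diff_eq (is_diffB (is_diffB dhz (is_diff_h u))
  (is_diff_comp (is_diff_grad u) (is_diff_dot p _)))).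
apply/funext => w; transitivity
  ('d h (u + p) (w + 0) - 'd h u w - dot p ('d (grad h) u w)) => //.
have hE x y : 'd h x y = dot (grad h x) y by apply: diff_gradE; exact: h2.1.
have gE : 'd (grad h) u w = hess h u *m w by apply: grad_diff_hess; exact: h2.2.
transitivity (dot (grad h (u + p)) w - dot (grad h u) w - dot p (hess h u *m w)).
  by congr (_ - _ - dot p _); [rewrite addr0; exact: hE|exact: hE|exact: gE].
by rewrite !dotDl !dotNl dot_mull hess_sym // dotC dot_mull hess_sym.
Qed.

Variables (alpha delta eta : R -> R) (t : R).
Local Notation L := (lagrangian alpha delta eta h f).

Lemma lagrangian_grad_v (x v : 'cV[R]_n) :
  differentiable (fun v => L x v t) v /\
  grad (fun v => L x v t) v = expR (delta t + eta t - alpha t) *: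
    (grad h (x + expR (- alpha t) *: v) - grad h x).
Proof.
pose B v := bregman h (x + expR (- alpha t) *: v) x.
have LE : (fun v => L x v t) = expR (delta t) *: (expR (eta t) *: B - cst (f x)).
  by apply/funext.
have dL := is_diffZ (expR (delta t)) (is_diffB (is_diffZ (expR (eta t))
  (is_diff_bregman_fst x v (expR (- alpha t)))) (is_diff_cst (f x) v)).
rewrite LE; split; first exact: ex_diff.
apply: (grad_unique dL) => w.
rewrite !expRD !dotZl -!mulrA.
by transitivity (expR (delta t) * (expR (eta t) * dot (expR (- alpha t) *:
  (grad h (x + expR (- alpha t) *: v) - grad h x)) w - 0)) => //; rewrite subr0 dotZl.
Qed.

Lemma lagrangian_grad_x (u v : 'cV[R]_n) :
  let p := expR (- alpha t) *: v in
  differentiable (fun u => L u v t) u /\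
  grad (fun u => L u v t) u = expR (delta t) *:
    (expR (eta t) *: (grad h (u + p) - grad h u - hess h u *m p) - grad f u).
Proof.
move=> p; pose B u := bregman h (u + p) u.
have LE : (fun u => L u v t) = expR (delta t) *: (expR (eta t) *: B - f).
  by apply/funext.
have dfu : is_diff u f ('d f u) by apply: DiffDef.
have dL := is_diffZ (expR (delta t)) (is_diffB (is_diffZ (expR (eta t))
  (is_diff_bregman_shift u p)) dfu).
rewrite LE; split; first exact: ex_diff.
apply: (grad_unique dL) => w.
rewrite dotZl dotDl dotZl dotNl.
by transitivity (expR (delta t) * (expR (eta t) *
  dot (grad h (u + p) - grad h u - hess h u *m p) w - 'd f u w)) => //; rewrite diff_gradE.
Qed.
End lagrangian_gradients.

(** * Differentiation along the curve and pointwise forms of the equations *)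

Section curves.
Context {R : realType} {n : nat} (A : set R) (h f : 'cV[R]_n -> R).
Context (alpha delta eta : R -> R) (x : R -> 'cV[R]_n) (t : R).
Hypotheses (A_proper : ProperFilter (within A t^')).
Hypotheses (alpha_diff : derivable_within A alpha t)
  (delta_diff : derivable_within A delta t) (eta_diff : derivable_within A eta t)
  (x_diff : derivable_within A x t)
  (x_diff2 : derivable_within A (derive_within A x) t).
Hypothesis h2 : twice_differentiable h.

Local Notation d := (derive_within A).
Local Notation dx := (derive_within A x).
Local Notation z := (zcurve A alpha x).
Local Notation a := (expR (alpha t)).
Local Notation k := (d delta t + d eta t - d alpha t - a).

Lemma is_derive_within_zcurve : is_derive_within A z t
  (dx t + ((- d alpha t * expR (- alpha t)) *: dx t + expR (- alpha t) *: d dx t)).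
Proof.
apply: is_derive_withinD; first exact: x_diff.
apply: (is_derive_withinZ _ x_diff2).
exact: is_derive_within_expR (is_derive_withinN alpha_diff).
Qed.

(** The derivative of [z], solved for the second derivative of [x]. *)
Lemma derive_within2_zcurve : d dx t = a *: d z t - (a - d alpha t) *: dx t.
Proof.
rewrite (derive_withinE A_proper is_derive_within_zcurve) expRN.
apply/matrixP => i j; rewrite !mxE; field.
by rewrite gt_eqF // expR_gt0.
Qed.

(** The function is the gradient in [v] of the Lagrangian along the curve; the chain rule through
    [grad h] produces the two Hessian terms. *)
Lemma is_derive_within_grad_v : is_derive_within A
  (fun s => expR (delta s + eta s - alpha s) *: (grad h (z s) - grad h (x s))) t
  (expR (delta t + eta t - alpha t) *:
    ((d delta t + d eta t - d alpha t) *: (grad h (z t) - grad h (x t)) +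
     (hess h (z t) *m d z t - hess h (x t) *m dx t))).
Proof.
have dz : is_derive_within A z t (d z t).
  exact: is_derive_within_derivable is_derive_within_zcurve.
have comp_grad g (l : 'cV[R]_n) : is_derive_within A g t l ->
    is_derive_within A (grad h \o g) t (hess h (g t) *m l).
  move=> gl; rewrite -grad_diff_hess; last exact: h2.2.
  by apply: is_derive_within_comp gl; exact: h2.2.
rewrite scalerDr scalerA [_ * (_ - _)]mulrC.
apply: (is_derive_withinZ (a := fun s => expR (delta s + eta s - alpha s))
  (g := fun s => grad h (z s) - grad h (x s))).
  apply: is_derive_within_expR.
  exact: is_derive_withinD (is_derive_withinD delta_diff eta_diff)
    (is_derive_withinN alpha_diff).
exact: is_derive_withinD (comp_grad _ _ dz) (is_derive_withinN (comp_grad _ _ x_diff)).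
Qed.

(* Symmetry of the Hessian makes the two [hess h (x t) *m dx t] terms cancel. *)
Lemma euler_lagrange_residual :
  expR (delta t + eta t - alpha t) *:
    ((d delta t + d eta t - d alpha t) *: (grad h (z t) - grad h (x t)) +
     (hess h (z t) *m d z t - hess h (x t) *m dx t))
  - expR (delta t) *: (expR (eta t) *: (grad h (z t) - grad h (x t)
      - hess h (x t) *m (expR (- alpha t) *: dx t)) - grad f (x t))
  = expR (delta t + eta t - alpha t) *: (hess h (z t) *m d z t
     - (- k *: (grad h (z t) - grad h (x t)) - expR (- eta t + alpha t) *: grad f (x t))).
Proof.
have scaleE (H : 'M[R]_n) (c : R) v : H *m (c *: v) = c *: (H *m v).
  by rewrite scalemxAr.
move: (d z t) (d delta t) (d eta t) (d alpha t) (dx t).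
move: (hess h (z t)) (hess h (x t)) (grad h (z t)) (grad h (x t)).
move=> Hz Hx gz gx vz d1 d2 d3 vx; rewrite scaleE !expRD !expRN.
move: (Hz *m vz) (Hx *m vx) => {}vz {}vx.
apply/matrixP => i j; rewrite !mxE; field.
by rewrite !gt_eqF ?expR_gt0.
Qed.

(** The left side of the ODE is [a *: invmx (hess h (z t))] applied to the residual of the state
    equation, and both factors are invertible. *)
Lemma ode_state_equiv : hess h (z t) \in unitmx ->
  d dx t + (a - d alpha t) *: dx t + invmx (hess h (z t)) *m
    ((a * k) *: (grad h (z t) - grad h (x t))
      + expR (- eta t + 2 * alpha t) *: grad f (x t)) = 0
  <-> hess h (z t) *m d z t =
     - k *: (grad h (z t) - grad h (x t)) - expR (- eta t + alpha t) *: grad f (x t).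
Proof.
rewrite derive_within2_zcurve subrK.
move: (d z t) (d delta t) (d eta t) (d alpha t).
move: (hess h (z t)) (grad h (z t)) (grad h (x t)) (grad f (x t)).
move=> Hz gz gx gf vz d1 d2 d3 Hu.
set rhs := - _ *: _ - _.
have -> : a *: vz + invmx Hz *m ((a * (d1 + d2 - d3 - a)) *: (gz - gx)
    + expR (- eta t + 2 * alpha t) *: gf) = a *: (invmx Hz *m (Hz *m vz - rhs)).
  rewrite mulmxBr mulKmx // [RHS]scalerBr scalemxAr -mulmxN; congr (_ + _ *m _).
  rewrite /rhs mulrDl mul1r !expRD; apply/matrixP => i j; rewrite !mxE; ring.
split=> [/eqP|->]; last by rewrite subrr mulmx0 scaler0.
rewrite scaler_eq0 gt_eqF ?expR_gt0 //= => /eqP /(congr1 (mulmx Hz)).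
by rewrite mulKVmx // mulmx0 => /eqP; rewrite subr_eq0 => /eqP.
Qed.
End curves.

(** * Equivalence of the three equations on the interval *)

Theorem theorem1 (R : realType) (n : nat) (t0 T : R) (t0T : t0 < T)
    (alpha delta eta : R -> R)
    (alpha_diff : derivable_on `[t0, T]%classic alpha)
    (delta_diff : derivable_on `[t0, T]%classic delta)
    (eta_diff : derivable_on `[t0, T]%classic eta)
    (h : 'cV[R]_n -> R)
    (h_diff2 : twice_differentiable h)
    (h_sconvex : strongly_convex h)
    (f : 'cV[R]_n -> R)
    (f_diff : forall x, differentiable f x)
    (f_convex : convex_function setT f)
    (sigma : R) (sigma_ge0 : 0 <= sigma)
    (f_uconvex : uniformly_convex_wrt sigma h f)
    (x : R -> 'cV[R]_n)
    (x_diff : derivable_on `[t0, T]%classic x)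
    (x_diff2 : derivable_on `[t0, T]%classic (derive_within `[t0, T]%classic x)) :
  let I := `[t0, T]%classic in
  (euler_lagrange I (lagrangian alpha delta eta h f) x <->
   state_equation I alpha delta eta h f x (zcurve I alpha x)) /\
  (forall z : R -> 'cV[R]_n,
     state_equation I alpha delta eta h f x z <->
     (forall t, I t -> z t = zcurve I alpha x t) /\
     second_order_ode I alpha delta eta h f x).
Proof.
move=> I; have PF t (It : I t) := within_itv_dnbhs_proper t0T It.
set zc := zcurve I alpha x.
have dzc t : I t -> is_derive_within I zc t (derive_within I zc t).
  move=> It; apply: is_derive_within_derivable.
  by apply: is_derive_within_zcurve; [exact: alpha_diff|exact: x_diff|exact: x_diff2].
have dxE t : derive_within I x t = expR (alpha t) *: (zc t - x t).
  by rewrite /zc /zcurve addrC addKr scalerA -expRD subrr expR0 scale1r.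
pose P t := hess h (zc t) *m derive_within I zc t =
  - (derive_within I delta t + derive_within I eta t - derive_within I alpha t - expR (alpha t)) *:
      (grad h (zc t) - grad h (x t)) - expR (- eta t + alpha t) *: grad f (x t).
(* The first state equation forces [z] to agree with [zc] on [I], hence to have the same derivative
   within [I]; what remains is the pointwise condition [P]. *)
have stateE z : state_equation I alpha delta eta h f x z <->
    forall t, I t -> z t = zc t /\ P t.
  split=> [st|st].
    have zE t : I t -> z t = zc t.
      move=> /st[_ _ + _]; rewrite dxE => /scalerI xz.
      by apply/(addIr (- x t))/esym/xz; rewrite gt_eqF ?expR_gt0.
    move=> t It; split; first exact: zE.
    have [_ dz _] := st _ It.
    have dzE : derive_within I z t = derive_within I zc t.
      apply: derive_withinE; first exact: PF.
      apply: eq_is_derive_within It (dzc _ It) => s; rewrite inE => Is.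
      exact: esym (zE s Is).
    by rewrite dzE zE.
  move=> t It; have [zt Pt] := st t It.
  have dz : is_derive_within I z t (derive_within I zc t).
    apply: eq_is_derive_within It (dzc _ It) => s; rewrite inE => Is.
    exact: esym (proj1 (st s Is)).
  split; [exact: x_diff|exact: is_derive_within_derivable dz|by rewrite dxE zt|].
  by rewrite (derive_withinE (PF _ It) dz) zt.
pose gv s := expR (delta s + eta s - alpha s) *: (grad h (zc s) - grad h (x s)).
(* Valid for every real [s], not only in [I], so that [funext] can replace the function under the
   derivative. *)
have gvE s : grad (fun v => lagrangian alpha delta eta h f (x s) v s)
    (derive_within I x s) = gv s.
  exact: (lagrangian_grad_v f h_diff2 _ _ _ _ _ _).2.
have elE t (It : I t) : derivable_within I gv t /\
    (derive_within I gv t -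
      grad (fun u => lagrangian alpha delta eta h f u (derive_within I x t) t) (x t)
      = 0 <-> P t).
  have dg := is_derive_within_grad_v (alpha_diff _ It) (delta_diff _ It)
    (eta_diff _ It) (x_diff _ It) (x_diff2 _ It) h_diff2.
  split; first exact: is_derive_within_derivable dg.
  have gx := (lagrangian_grad_x h_diff2 f_diff alpha delta eta t (x t) (derive_within I x t)).2.
  rewrite (etrans (congr2 (fun p q => p - q) (derive_withinE (PF _ It) dg) gx)
    (euler_lagrange_residual _ _ _ _ _ _ _ _)).
  (* The equation now reads: a positive exponential times the residual of [P t] is 0. *)
  split=> [/eqP|->]; last by rewrite subrr scaler0.
  by rewrite scaler_eq0 gt_eqF ?expR_gt0 //= subr_eq0 => /eqP.
have HU t : hess h (zc t) \in unitmx by exact: hess_unit.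
have odeE t (It : I t) :=
  ode_state_equiv f delta eta (PF _ It) (alpha_diff _ It) (x_diff _ It) (x_diff2 _ It) (HU t).
split=> [|z]; rewrite stateE.
  rewrite /euler_lagrange (funext gvE); split=> el t It.
    split=> //; have [_ _ _ el0] := el t It.
    exact: (elE _ It).2.1 el0.
  have [dg [_ Pel]] := elE _ It; have [_ /Pel el0] := el t It.
  split; [|exact: (lagrangian_grad_v f h_diff2 _ _ _ _ _ _).1|exact: dg|exact: el0].
  exact: (lagrangian_grad_x h_diff2 f_diff _ _ _ _ _ _).1.
split=> [st|[zE ode] t It].
  split; first by move=> t /st[].
  move=> t It; have [_ Pt] := st t It.
  split; [exact: x_diff|exact: x_diff2|exact: HU|exact: (odeE t It).2 Pt].
split; first exact: zE.
by have [_ _ _ eq0] := ode t It; exact: (odeE t It).1 eq0.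
Qed.
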